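(* For any $p>1$ the function $$G_p(x,t)=t^{-\frac{n+p-2}{2(p-1)}}\exp\left(-\frac{|x|^2}{4(p-1)t}\right)$$ is a classical solution of $\operatorname{div}(|Du|^{p-2}Du)=|Du|^{p-2}u_t$ in $(\mathbb{R}^n\setminus\{0\})\times(0,\infty)$, and a viscosity solution of this equation in $\mathbb{R}^n\times(\varepsilon,\infty)$ for all $\varepsilon>0$.
   Context: $D$ denotes the spatial gradient. Viscosity solutions. A bounded continuous function $u$ on $\Omega\times I$, with $\Omega\subset\mathbb{R}^n$ open and $I$ a time interval, is a viscosity subsolution of $\operatorname{div}(|Du|^{p-2}Du)=|Du|^{p-2}u_t$ if, whenever $\phi$ is a $C^2$ function on $\Omega\times\operatorname{int}(I)$ and $u-\phi$ has a local maximum at $z_0\in\Omega\times\operatorname{int}(I)$, one has at $z_0$ (summing over repeated indices) $\phi_t\le\left(\delta_{ij}+(p-2)\frac{\phi_i\phi_j}{|D\phi|^2}\right)\phi_{ij}$ if $D\phi(z_0)\ne0$, and $\phi_t\le(\delta_{ij}+(p-2)a_ia_j)\phi_{ij}$ for some $a\in\mathbb{R}^n$ with $|a|\le1$ if $D\phi(z_0)=0$. A viscosity supersolution is defined with ''local minimum'' and the inequalities reversed ($\ge$). A viscosity solution is both a sub- and a supersolution. *)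

(* Defs.v *)
From HB Require Import structures.
From mathcomp Require Import all_boot all_order all_algebra.
From mathcomp Require Import all_classical all_reals all_analysis.

Set Implicit Arguments.
Unset Strict Implicit.
Unset Printing Implicit Defensive.

Import Order.TTheory GRing.Theory Num.Theory.
Import numFieldNormedType.Exports.

Local Open Scope classical_set_scope.
Local Open Scope ring_scope.

(* Points of space-time R^n x R are pairs z = (x, t), with x a row vector. *)

(* The library norm `|x| on 'rV[R]_n is the max norm (same topology), so the
   Euclidean norm |x| has to be introduced separately. *)
Definition enorm (R : realType) (n : nat) (x : 'rV[R]_n) : R :=
  Num.sqrt (\sum_(i < n) x ord0 i ^+ 2).

Definition Dx (R : realType) (n : nat) (i : 'I_n) (f : 'rV[R]_n * R -> R)
    (z : 'rV[R]_n * R) : R :=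
  'D_(delta_mx ord0 i, 0) f z.

Definition Dt (R : realType) (n : nat) (f : 'rV[R]_n * R -> R)
    (z : 'rV[R]_n * R) : R :=
  'D_(0, 1) f z.

Definition grad (R : realType) (n : nat) (f : 'rV[R]_n * R -> R)
    (z : 'rV[R]_n * R) : 'rV[R]_n :=
  \row_(i < n) Dx i f z.

Definition hess (R : realType) (n : nat) (f : 'rV[R]_n * R -> R)
    (z : 'rV[R]_n * R) : 'M[R]_n :=
  \matrix_(i < n, j < n) Dx j (Dx i f) z.

(* f is C^k on the open set U: f is C^(k+1) iff it is (Frechet) differentiable
   and its differential is C^k. On the finite-dimensional space R^n x R the
   latter means that z |-> 'D_v f z is C^k for every fixed v. The values of f
   outside U are irrelevant. *)
Fixpoint Ck_on (R : realType) (n : nat) (k : nat) (U : set ('rV[R]_n * R))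
    (f : 'rV[R]_n * R -> R) : Prop :=
  match k with
  | 0%N => forall z, U z -> {for z, continuous f}
  | k'.+1 => (forall z, U z -> differentiable f z) /\
             (forall v : 'rV[R]_n * R, Ck_on k' U ('D_v f))
  end.

(* i-th component of the vector field |Du|^(p-2) Du *)
Definition flux (R : realType) (n : nat) (p : R) (u : 'rV[R]_n * R -> R)
    (i : 'I_n) (z : 'rV[R]_n * R) : R :=
  enorm (grad u z) `^ (p - 2) * Dx i u z.

(* Since 'D_v and powR are total, a classical solution is asked that everything
   in the equation exists: the derivatives making up the divergence, and, when
   p < 2, the negative power of |Du|. *)
Definition classical_solution (R : realType) (n : nat) (p : R)
    (U : set ('rV[R]_n * R)) (u : 'rV[R]_n * R -> R) : Prop :=
  Ck_on 2 U u /\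
  forall z, U z ->
    [/\ p < 2 -> grad u z <> 0,
        forall i : 'I_n, derivable (flux p u i) z (delta_mx ord0 i, 0) &
        \sum_(i < n) Dx i (flux p u i) z
          = enorm (grad u z) `^ (p - 2) * Dt u z].

Definition op_regular (R : realType) (n : nat) (p : R)
    (q : 'rV[R]_n) (H : 'M[R]_n) : R :=
  \sum_(i < n) \sum_(j < n)
    ((i == j)%:R + (p - 2) * (q ord0 i * q ord0 j / enorm q ^+ 2)) * H i j.

Definition op_singular (R : realType) (n : nat) (p : R)
    (a : 'rV[R]_n) (H : 'M[R]_n) : R :=
  \sum_(i < n) \sum_(j < n)
    ((i == j)%:R + (p - 2) * (a ord0 i * a ord0 j)) * H i j.

Definition local_max_in (R : realType) (n : nat) (D : set ('rV[R]_n * R))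
    (w : 'rV[R]_n * R -> R) (z0 : 'rV[R]_n * R) : Prop :=
  \forall z \near z0, D z -> w z <= w z0.

Definition local_min_in (R : realType) (n : nat) (D : set ('rV[R]_n * R))
    (w : 'rV[R]_n * R -> R) (z0 : 'rV[R]_n * R) : Prop :=
  \forall z \near z0, D z -> w z0 <= w z.

(* In the three definitions below Omega is meant to be open. *)
Definition viscosity_subsolution (R : realType) (n : nat) (p : R)
    (Omega : set 'rV[R]_n) (I : interval R) (u : 'rV[R]_n * R -> R) : Prop :=
  let D := Omega `*` [set` I]° in
  [/\ [bounded u z | z in Omega `*` [set` I]],
      {within Omega `*` [set` I], continuous u} &
      forall (phi : 'rV[R]_n * R -> R) (z0 : 'rV[R]_n * R),
        Ck_on 2 D phi -> D z0 ->
        local_max_in D (fun z => u z - phi z) z0 ->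
        (grad phi z0 <> 0 ->
           Dt phi z0 <= op_regular p (grad phi z0) (hess phi z0)) /\
        (grad phi z0 = 0 ->
           exists a : 'rV[R]_n,
             enorm a <= 1 /\ Dt phi z0 <= op_singular p a (hess phi z0))].

Definition viscosity_supersolution (R : realType) (n : nat) (p : R)
    (Omega : set 'rV[R]_n) (I : interval R) (u : 'rV[R]_n * R -> R) : Prop :=
  let D := Omega `*` [set` I]° in
  [/\ [bounded u z | z in Omega `*` [set` I]],
      {within Omega `*` [set` I], continuous u} &
      forall (phi : 'rV[R]_n * R -> R) (z0 : 'rV[R]_n * R),
        Ck_on 2 D phi -> D z0 ->
        local_min_in D (fun z => u z - phi z) z0 ->
        (grad phi z0 <> 0 ->
           Dt phi z0 >= op_regular p (grad phi z0) (hess phi z0)) /\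
        (grad phi z0 = 0 ->
           exists a : 'rV[R]_n,
             enorm a <= 1 /\ Dt phi z0 >= op_singular p a (hess phi z0))].

Definition viscosity_solution (R : realType) (n : nat) (p : R)
    (Omega : set 'rV[R]_n) (I : interval R) (u : 'rV[R]_n * R -> R) : Prop :=
  viscosity_subsolution p Omega I u /\ viscosity_supersolution p Omega I u.

Definition Gp (R : realType) (n : nat) (p : R) (z : 'rV[R]_n * R) : R :=
  z.2 `^ (- ((n%:R + p - 2) / (2 * (p - 1)))) *
  expR (- (enorm z.1 ^+ 2 / (4 * (p - 1) * z.2))).

(* Main.v *)
Require Import Defs.
From HB Require Import structures.
From mathcomp Require Import all_boot all_order all_algebra.
From mathcomp Require Import all_classical all_reals all_analysis.
From mathcomp Require Import ring lra.

Import Order.TTheory GRing.Theory Num.Theory.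
Import numFieldNormedType.Exports.

Local Open Scope classical_set_scope.
Local Open Scope ring_scope.

(* With kappa = 1 / (4 (p - 1)) and b = 1 / (2 (p - 1) t), the function
   G = t^(-alpha) exp (- kappa |x|^2 / t) is smooth for t > 0, the origin x = 0
   included, with DG = - b G x and D^2 G = G (b^2 x x^T - b I). Writing x = c e with
   |e| = 1 one gets G_t = tr ((I + (p - 2) e e^T) D^2 G) everywhere, any unit e being
   allowed at x = 0. Where Du <> 0, div (|Du|^(p-2) Du) is |Du|^(p-2) times this
   trace with e = Du / |Du|, which gives the classical equation. A test function
   touching G from above has the same first derivatives and a larger spatial Hessian,
   and I + (p - 2) e e^T is positive semidefinite since p > 1; the same e thus
   witnesses the viscosity inequality, and similarly from below. *)

(** * Differential calculus along lines and the second derivative test *)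

(** The difference [g - f] vanishes near [z], so its differential there is zero, and [g] is the sum
    of this difference and [f]. *)
Lemma near_eq_differentiable {R : realType} {V : normedModType R}
    (f g : V -> R) (z : V) :
  (\near z, f z = g z) -> differentiable f z -> differentiable g z.
Proof.
move=> fg df; have gfz : (g - f) z = 0.
  by rewrite !fctE (nbhs_singleton fg) subrr.
have gfo : (g - f) \o shift z = cst ((g - f) z) + \0 +o_ 0 id.
  apply/eqaddoP => _/posnumP[e]; near=> y.
  suff E : (g - f) (y + z) = 0.
    by rewrite !fctE /= in gfz E *; rewrite gfz E addr0 subr0 normr0 mulr_ge0.
  rewrite !fctE; apply/eqP; rewrite subr_eq0 eq_sym; apply/eqP; near: y.
  have lc : (y + z) @[y --> (0 : V)] --> z.
    by rewrite -[X in _ --> X]add0r; apply: cvgD; [exact: cvg_id|exact: cvg_cst].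
  exact: lc fg.
have d0 : 'd (g - f) z = \0 :> (V -> R).
  by apply: diff_unique => //; exact: cst_continuous.
rewrite -[g](subrK f); apply: differentiableD => //.
by apply/diff_locallyP; rewrite d0; split => //; exact: cst_continuous.
Unshelve. all: by end_near. Qed.

Lemma derive_comp_real {R : realType} {V : normedModType R} (f : V -> R)
    (g : R -> R) (z v : V) (dg : R) :
  differentiable f z -> is_derive (f z) 1 g dg ->
  differentiable (g \o f) z /\ 'D_v (g \o f) z = dg * 'D_v f z.
Proof.
move=> df [dgf gE].
have dg' : differentiable g (f z) by apply/derivable1_diffP.
have dgf' : differentiable (g \o f) z by exact: differentiable_comp.
split=> //; rewrite !deriveE// diff_comp//= diff1E//= derive1E gE.
by rewrite mulrC.
Qed.

(** Turns a directional derivative into a one-variable one, so that Fermat's rule and the mean value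
    theorem for real functions apply. *)
Lemma derive_line {R : realType} {V : normedModType R} (w : V -> R) (z v : V)
    (h : R) : derivable w (h *: v + z) v ->
  is_derive h 1 (fun k => w (k *: v + z)) ('D_v w (h *: v + z)).
Proof.
move=> dw.
have E : (fun k : R => k^-1 *: (((fun k => w (k *: v + z)) \o shift h) (k *: 1)
    - w (h *: v + z))) =
  (fun k : R => k^-1 *: ((w \o shift (h *: v + z)) (k *: v) - w (h *: v + z))).
  apply/funext => k /=; congr (_ *: (w _ - _)).
  by rewrite scalerDl -addrA [k *: 1]mulr1.
by split; rewrite /derivable /derive /= E.
Qed.

(** On the line through [z] in direction [v] the first derivative vanishes at the maximum. Were the
    second one positive, the first would be positive just after [z], and the mean value theorem
    would give a value above the maximum. *)
Lemma local_max_derive2 {R : realType} {V : normedModType R} (w : V -> R)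
    (z v : V) :
  (\forall y \near z, derivable w y v) -> derivable ('D_v w) z v ->
  (\forall y \near z, w y <= w z) ->
  'D_v w z = 0 /\ 'D_v ('D_v w) z <= 0.
Proof.
move=> dw ddw wmax; pose g k := w (k *: v + z).
have lc : (h *: v + z) @[h --> (0 : R)] --> z.
  rewrite -[X in _ --> X]add0r -(scale0r v).
  by apply: cvgD; [exact: scalel_continuous|exact: cvg_cst].
have : \forall h \near (0 : R),
    derivable w (h *: v + z) v /\ w (h *: v + z) <= w z.
  have : \forall y \near z, derivable w y v /\ w y <= w z.
    by near=> y; split; near: y.
  by move/lc.
move=> /nbhs_ballP[e /= e0 He].
have gd (h : R) : `|h| < e -> is_derive h (1 : R) (g : R -> R) ('D_v w (h *: v + z)).
  by move=> he; apply: derive_line; apply He; rewrite /ball/= sub0r normrN.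
have gm (h : R) : `|h| < e -> g h <= g 0.
  move=> he; rewrite /g scale0r add0r; apply He.
  by rewrite /ball/= sub0r normrN.
have g0 : 'D_v w z = 0.
  have [||||_] := @derive1_at_max _ g (- e) e 0.
  - by lra.
  - by move=> t; rewrite in_itv/= -ltr_norml => /gd [].
  - by rewrite in_itv/= oppr_lt0 e0.
  - by move=> t; rewrite in_itv/= -ltr_norml => /gm.
  have /gd [_ ->] : `|0 : R| < e by rewrite normr0.
  by rewrite scale0r add0r.
split=> //; rewrite leNgt; apply/negP => c0.
have /cvg_ex[l cl] := ddw.
have lE : 'D_v ('D_v w) z = l := cvg_lim (@norm_hausdorff _ _) cl.
rewrite lE in c0 => {lE}.
have : \forall h \near 0^', 0 < h^-1 *: ('D_v w (h *: v + z) - 'D_v w z).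
  exact: (cvgr_gt _ cl _ c0).
move=> /nbhs_ballP[d /= d0 Hd].
(* [m] lies strictly inside both radii: [e] for derivability and the maximum, [d] for the sign of
   the difference quotient. *)
pose m := Num.min e d / 2.
have m0 : 0 < m by rewrite divr_gt0// lt_min e0.
have me : m < e by rewrite ltr_pdivrMr// gt_min; apply/orP; left; lra.
have md : m < d by rewrite ltr_pdivrMr// gt_min; apply/orP; right; lra.
have [||c] := @MVT _ g (fun h => 'D_v w (h *: v + z)) 0 m m0.
- move=> h; rewrite in_itv/= => /andP[h0 hm]; apply: gd.
  by rewrite gtr0_norm// (lt_trans hm).
- apply: derivable_within_continuous => h; rewrite in_itv/= => /andP[h0 hm].
  by have [] := gd h; rewrite ?ger0_norm// (le_lt_trans hm).
rewrite in_itv/= subr0 => /andP[h0 cm] gE.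
have := Hd c; rewrite /ball/= sub0r normrN gtr0_norm// (lt_trans cm)// gt_eqF//.
move=> /(_ isT isT); rewrite g0 subr0.
rewrite [_ *: _]mulrC pmulr_lgt0 ?invr_gt0// => Dc.
have := gm m; rewrite gtr0_norm// => /(_ me).
by apply/negP; rewrite -ltNge -subr_gt0 gE mulr_gt0.
Unshelve. all: by end_near. Qed.

(** * Closure properties of the class C^k *)

(** Derivative rules hold only at points of [U], whereas ['D_v f] is a total function; this lets the
    inductions below replace ['D_v f] by its formula. Since [U] is open, agreement on [U] is
    agreement near each of its points. *)
Lemma Ck_on_eq {R : realType} {n : nat} (k : nat) (U : set ('rV[R]_n * R))
    (f g : 'rV[R]_n * R -> R) :
  open U -> {in U, f =1 g} -> Ck_on k U f -> Ck_on k U g.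
Proof.
move=> oU; have near_eq f' g' z : {in U, f' =1 g'} -> U z ->
    \forall y \near z, f' y = g' y :> R.
  move=> fg Uz; apply: filterS (open_nbhs_nbhs (conj oU Uz)) => y Uy.
  by apply: fg; rewrite inE.
elim: k f g => [|k IH] f g fg /=.
  move=> cf z Uz; rewrite /prop_for /continuous_at -(fg z) ?inE//.
  by apply: cvg_trans (cf z Uz); apply: near_eq_cvg; exact: near_eq.
move=> [df Df]; split=> [z Uz|v].
  by apply: near_eq_differentiable (df z Uz); exact: near_eq.
apply: IH (Df v) => z /[!inE] Uz.
by apply: near_eq_derive; exact: near_eq.
Qed.

Lemma Ck_on_sub {R : realType} {n : nat} (k : nat) (U U' : set ('rV[R]_n * R))
    (f : 'rV[R]_n * R -> R) : U' `<=` U -> Ck_on k U f -> Ck_on k U' f.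
Proof.
move=> UU'; elim: k f => [|k IH] f /= => [cf z /UU'/cf//|[df Df]].
by split=> [z /UU'/df//|v]; apply: IH.
Qed.

(** The product and chain rules leave some factors undifferentiated; the induction steps use these
    factors one order lower. *)
Lemma Ck_on_pred {R : realType} {n : nat} (k : nat) (U : set ('rV[R]_n * R))
    (f : 'rV[R]_n * R -> R) : Ck_on k.+1 U f -> Ck_on k U f.
Proof.
elim: k f => [|k IH] f [df Df].
  by move=> z /df; exact: differentiable_continuous.
by split=> // v; apply: IH.
Qed.

Lemma Ck_on_cst {R : realType} {n : nat} (k : nat) (U : set ('rV[R]_n * R))
    (a : R) : Ck_on k U (cst a).
Proof.
elim: k a => [|k IH] a /=; first by move=> z _; exact: cst_continuous.
split=> // v.
rewrite (_ : 'D_v (cst a) = cst 0); first exact: IH.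
by apply/funext => z; rewrite derive_cst.
Qed.

Lemma linear_derive {R : realType} {V : normedModType R} (f : V -> R) (z v : V) :
  linear f -> continuous f -> differentiable f z /\ 'D_v f z = f v.
Proof.
(* [linear f] is a mere proposition; packing it as a structure gives access to
   [linear_differentiable] and [diff_lin]. *)
move=> lf; pose m := GRing.isLinear.Build _ _ _ _ _ lf.
pose F : {linear V -> R} := HB.pack f m.
rewrite (_ : f = F)// => cf; have dF := linear_differentiable z cf.
by split=> //; rewrite deriveE// diff_lin.
Qed.

Lemma Ck_on_linear {R : realType} {n : nat} (k : nat) (U : set ('rV[R]_n * R))
    (f : 'rV[R]_n * R -> R) : linear f -> continuous f -> Ck_on k U f.
Proof.
move=> lf cf; case: k => [|k] /=; first by move=> z _; exact: cf.
split=> [z _|v]; first exact: (linear_derive _ z 0 lf cf).1.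
rewrite (_ : 'D_v f = cst (f v)); first exact: Ck_on_cst.
by apply/funext => z; exact: (linear_derive _ z v lf cf).2.
Qed.

Lemma Ck_onD {R : realType} {n : nat} (k : nat) (U : set ('rV[R]_n * R))
    (f g : 'rV[R]_n * R -> R) :
  open U -> Ck_on k U f -> Ck_on k U g -> Ck_on k U (f + g).
Proof.
move=> oU; elim: k f g => [|k IH] f g /=.
  by move=> cf cg z Uz; apply: cvgD; [exact: cf|exact: cg].
move=> [df Df] [dg Dg]; split=> [z Uz|v].
  by apply: differentiableD; [exact: df|exact: dg].
apply: Ck_on_eq oU _ (IH _ _ (Df v) (Dg v)) => z /[!inE] Uz.
by rewrite deriveD//; apply: diff_derivable; [exact: df|exact: dg].
Qed.

Lemma Ck_onM {R : realType} {n : nat} (k : nat) (U : set ('rV[R]_n * R))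
    (f g : 'rV[R]_n * R -> R) :
  open U -> Ck_on k U f -> Ck_on k U g -> Ck_on k U (f * g).
Proof.
move=> oU; elim: k f g => [|k IH] f g.
  by move=> cf cg z Uz; apply: cvgM; [exact: cf|exact: cg].
move=> Cf Cg; have [df Df] := Cf; have [dg Dg] := Cg; split=> [z Uz|v].
  by apply: differentiableM; [exact: df|exact: dg].
have Ck := Ck_onD _ _ _ _ oU (IH _ _ (Ck_on_pred _ _ _ Cf) (Dg v))
                             (IH _ _ (Ck_on_pred _ _ _ Cg) (Df v)).
apply: Ck_on_eq oU _ Ck => z /[!inE] Uz.
by rewrite deriveM//; apply: diff_derivable; [exact: df|exact: dg].
Qed.

Lemma Ck_on_sum {R : realType} {n : nat} (k : nat) (U : set ('rV[R]_n * R))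
    (m : nat) (f : 'I_m -> 'rV[R]_n * R -> R) :
  open U -> (forall i, Ck_on k U (f i)) -> Ck_on k U (\sum_(i < m) f i).
Proof.
move=> oU Cf; apply: (big_ind (Ck_on k U)) => [|g h|i _] //.
  exact: Ck_on_cst.
exact: Ck_onD.
Qed.

(** The derivative is minus the squared inverse times ['D_v f], a product in which the inverse
    itself recurs, so the induction on [k] closes with [f] fixed. *)
Lemma Ck_onV {R : realType} {n : nat} (k : nat) (U : set ('rV[R]_n * R))
    (f : 'rV[R]_n * R -> R) : open U -> (forall z, U z -> f z != 0) ->
  Ck_on k U f -> Ck_on k U (fun z => (f z)^-1).
Proof.
move=> oU f0; elim: k => [|k IH].
  by move=> cf z Uz; apply: cvgV; [exact: f0|exact: cf].
move=> Cf; have [df Df] := Cf; split=> [z Uz|v].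
  by apply: differentiableV; [exact: df|exact: f0].
have CV := IH (Ck_on_pred _ _ _ Cf).
have Ck := Ck_onM _ _ _ _ oU (Ck_on_cst k U (-1))
  (Ck_onM _ _ _ _ oU (Ck_onM _ _ _ _ oU CV CV) (Df v)).
apply: Ck_on_eq oU _ Ck => z /[!inE] Uz.
rewrite deriveV; [|exact: f0|by apply: diff_derivable; exact: df].
by rewrite !fctE mulN1r -invfM -expr2 -mulNr.
Qed.

(** One differentiation gives the inverse of [f] times ['D_v f], so [Ck_onV] takes the place of an
    induction. *)
Lemma Ck_on_ln {R : realType} {n : nat} (k : nat) (U : set ('rV[R]_n * R))
    (f : 'rV[R]_n * R -> R) : open U -> (forall z, U z -> 0 < f z) ->
  Ck_on k U f -> Ck_on k U (@ln R \o f).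
Proof.
move=> oU f0; case: k => [|k] Cf.
  by move=> z Uz; apply: continuous_comp; [exact: Cf|exact/continuous_ln/f0].
have [df Df] := Cf.
have dln z v : U z -> differentiable (@ln R \o f) z /\
    'D_v (@ln R \o f) z = (f z)^-1 * 'D_v f z.
  move=> Uz; apply: derive_comp_real; first exact: df.
  exact: is_derive1_ln (f0 _ Uz).
split=> [z Uz|v]; first by have [] := dln z 0 Uz.
have CV : Ck_on k U (fun z => (f z)^-1).
  by apply: Ck_onV (Ck_on_pred _ _ _ Cf) => // z /f0 /lt0r_neq0.
apply: Ck_on_eq oU _ (Ck_onM _ _ _ _ oU CV (Df v)) => z /[!inE] Uz.
by have [_ ->] := dln z v Uz.
Qed.

Lemma Ck_on_expR {R : realType} {n : nat} (k : nat) (U : set ('rV[R]_n * R))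
    (f : 'rV[R]_n * R -> R) :
  open U -> Ck_on k U f -> Ck_on k U (expR \o f).
Proof.
move=> oU; elim: k => [|k IH].
  by move=> cf z Uz; apply: continuous_comp; [exact: cf|exact: continuous_expR].
move=> Cf; have [df Df] := Cf.
have dexp z v : U z -> differentiable (expR \o f) z /\
    'D_v (expR \o f) z = expR (f z) * 'D_v f z.
  by move=> Uz; apply: derive_comp_real; exact: df.
split=> [z Uz|v]; first by have [] := dexp z 0 Uz.
have Ck := Ck_onM _ _ _ _ oU (IH (Ck_on_pred _ _ _ Cf)) (Df v).
apply: Ck_on_eq oU _ Ck => z /[!inE] Uz.
by have [_ ->] := dexp z v Uz.
Qed.

(** * The Euclidean norm and the ellipticity of the operators *)

Lemma enorm_ge0 {R : realType} {n : nat} (x : 'rV[R]_n) : 0 <= enorm x.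
Proof. exact: sqrtr_ge0. Qed.

Lemma sqr_enorm {R : realType} {n : nat} (x : 'rV[R]_n) :
  enorm x ^+ 2 = \sum_(i < n) x ord0 i ^+ 2.
Proof. by rewrite sqr_sqrtr// sumr_ge0// => i _; apply: sqr_ge0. Qed.

Lemma enorm_eq0 {R : realType} {n : nat} (x : 'rV[R]_n) :
  (enorm x == 0) = (x == 0).
Proof.
rewrite -sqrf_eq0 sqr_enorm psumr_eq0; last by move=> i _; apply: sqr_ge0.
apply/allP/eqP => [x0|-> i _]; last by rewrite mxE expr0n eqxx.
apply/rowP => i; rewrite mxE; apply/eqP; rewrite -sqrf_eq0.
exact: x0 i (mem_index_enum i).
Qed.

Lemma enormZ {R : realType} {n : nat} (a : R) (x : 'rV[R]_n) :
  enorm (a *: x) = `|a| * enorm x.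
Proof.
rewrite /enorm -sqrtr_sqr -sqrtrM ?sqr_ge0// mulr_sumr.
by congr Num.sqrt; apply: eq_bigr => i _; rewrite mxE exprMn.
Qed.

Lemma enorm_delta {R : realType} {n : nat} (i : 'I_n) :
  enorm (delta_mx ord0 i : 'rV[R]_n) = 1.
Proof.
rewrite /enorm (bigD1 i)//= big1 => [|j ji].
  by rewrite mxE !eqxx expr1n addr0 sqrtr1.
by rewrite mxE (negbTE ji) andbF expr0n.
Qed.

Lemma enorm_normalize {R : realType} {n : nat} (q : 'rV[R]_n) :
  q <> 0 -> enorm ((enorm q)^-1 *: q) = 1.
Proof.
move=> /eqP; rewrite -enorm_eq0 => q0.
by rewrite enormZ ger0_norm ?invr_ge0 ?enorm_ge0// mulVf.
Qed.

(** The matrix q q^T / |q|^2 depends only on the line spanned by q. *)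
Lemma op_regularZ {R : realType} {n : nat} (p a : R) (e : 'rV[R]_n)
    (H : 'M[R]_n) : a != 0 -> enorm e = 1 ->
  op_regular p (a *: e) H = op_singular p e H.
Proof.
move=> a0 e1; apply: eq_bigr => i _; apply: eq_bigr => j _.
congr ((_ + _ * _) * _).
by rewrite !mxE enormZ e1 mulr1 real_normK ?num_real//; field.
Qed.

Definition quadratic_form {R : realType} {n : nat} (H : 'M[R]_n)
  (y : 'rV[R]_n) : R := \sum_(i < n) \sum_(j < n) y ord0 i * y ord0 j * H i j.

(* For a unit vector e, I + (p - 2) e e^T is the square of the symmetric matrix
   I + c e e^T with (1 + c)^2 = p - 1, whose rows are the vectors below. *)
Lemma op_singular_sum_quadratic_form {R : realType} {n : nat} (p : R)
    (e : 'rV[R]_n) (H : 'M[R]_n) : 1 < p -> enorm e = 1 ->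
  op_singular p e H = \sum_(k < n) quadratic_form H
    (delta_mx ord0 k + ((Num.sqrt (p - 1) - 1) * e ord0 k) *: e).
Proof.
move=> p1 e1; set c := _ - 1.
have cE : 2 * c + c ^+ 2 = p - 2.
  have /sqr_sqrtr : 0 <= p - 1 by lra.
  by rewrite /c => sE; rewrite sqrrB sE; ring.
(* Both sides are linear in [H]; moving the sum over [k] inside reduces the identity to the
   coefficient of each [H i j]. *)
rewrite [RHS]exchange_big/=; apply: eq_bigr => i _.
rewrite [RHS]exchange_big/=; apply: eq_bigr => j _.
rewrite -mulr_suml; congr (_ * _).
pose d (k l : 'I_n) : R := (k == l)%:R.
have sumd (l : 'I_n) (F : 'I_n -> R) : \sum_k d k l * F k = F l.
  rewrite (bigD1 l)//= big1 => [|k kl]; last by rewrite /d (negbTE kl) mul0r.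
  by rewrite /d eqxx mul1r addr0.
(* This expands the product of the [i]-th and [j]-th entries of the [k]-th vector. Summing over [k]
   with |e| = 1 gives e_i e_j the coefficient [2 * c + c ^+ 2], which is [p - 2]. *)
transitivity (\sum_k (d k i * d k j + d k i * (c * e ord0 k * e ord0 j)
    + d k j * (c * e ord0 k * e ord0 i)
    + c ^+ 2 * (e ord0 i * e ord0 j) * e ord0 k ^+ 2)).
  rewrite !big_split/= !sumd -mulr_sumr -sqr_enorm e1 -cE /d; ring.
apply: eq_bigr => k _; rewrite !mxE !eqxx/= /d ![_ == k]eq_sym; ring.
Qed.

(** Ellipticity: the operator is a sum of values of the quadratic form, hence monotone in it. *)
Lemma op_singular_le {R : realType} {n : nat} (p : R) (e : 'rV[R]_n)
    (H H' : 'M[R]_n) : 1 < p -> enorm e = 1 ->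
  (forall y, quadratic_form H y <= quadratic_form H' y) ->
  op_singular p e H <= op_singular p e H'.
Proof.
move=> p1 e1 HH'; rewrite !op_singular_sum_quadratic_form//.
by apply: ler_sum => k _; exact: HH'.
Qed.

(** * Derivatives at a point of touching *)

Lemma derive_space {R : realType} {n : nat} (f : 'rV[R]_n * R -> R)
    (z : 'rV[R]_n * R) (y : 'rV[R]_n) : differentiable f z ->
  'D_(y, 0) f z = \sum_(i < n) y ord0 i * Dx i f z.
Proof.
move=> df; under eq_bigr do rewrite /Dx deriveE//.
rewrite deriveE// (_ : (y, 0) =
  \sum_(i < n) y ord0 i *: ((delta_mx ord0 i, 0) : 'rV[R]_n * R)).
  by rewrite linear_sum; apply: eq_bigr => i _; rewrite linearZ.
rewrite [in LHS](row_sum_delta y) [RHS]surjective_pairing.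
congr pair.
  by rewrite (big_morph fst (id1 := 0) (op1 := +%R)).
rewrite (big_morph snd (id1 := 0) (op1 := +%R))// big1// => i _.
by rewrite /= scaler0.
Qed.

(** Links second derivatives along lines, which the maximum test controls, to the matrix entries in
    the operators. *)
Lemma derive2_space {R : realType} {n : nat} (U : set ('rV[R]_n * R))
    (f : 'rV[R]_n * R -> R) (z : 'rV[R]_n * R) (y : 'rV[R]_n) :
  open U -> Ck_on 2 U f -> U z ->
  'D_(y, 0) ('D_(y, 0) f) z = quadratic_form (hess f z) y.
Proof.
move=> oU [df Df] Uz.
have dDf v : differentiable ('D_v f) z by have [+ _] := Df v; apply.
(* The expansion of ['D_(y, 0) f] holds on [U], a neighbourhood of [z], so it may be differentiated
   once more at [z]. *)
rewrite (@near_eq_derive _ _ _ _ (\sum_(i < n) y ord0 i \*o Dx i f)).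
  rewrite derive_sum => [|i]; last first.
    by apply: derivableZ; apply: diff_derivable; exact: dDf.
  apply: eq_bigr => i _; rewrite deriveMl; last first.
    by apply: diff_derivable; exact: dDf.
  rewrite derive_space ?mulr_sumr; last exact: dDf.
  by apply: eq_bigr => j _; rewrite mxE mulrA.
apply: filterS (open_nbhs_nbhs (conj oU Uz)) => w Uw.
by rewrite derive_space ?fct_sumE//; exact: df.
Qed.

(** The second derivative test for [f - g] on every line through [z]: coordinate and time directions
    equate the first derivatives, spatial directions compare the Hessians. *)
Lemma local_max_sub_Ck2 {R : realType} {n : nat} (D : set ('rV[R]_n * R))
    (f g : 'rV[R]_n * R -> R) (z : 'rV[R]_n * R) :
  open D -> Ck_on 2 D f -> Ck_on 2 D g -> D z ->
  local_max_in D (fun z => f z - g z) z ->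
  [/\ grad f z = grad g z, Dt f z = Dt g z &
      forall y, quadratic_form (hess f z) y <= quadratic_form (hess g z) y].
Proof.
move=> oD Cf Cg Dz fgmax; have [df Df] := Cf; have [dg Dg] := Cg.
have nD : \forall y \near z, D y by exact: open_nbhs_nbhs.
have nDfg v : \forall y \near z, 'D_v (f - g) y = ('D_v f - 'D_v g) y.
  near=> y; have Dy : D y by near: y.
  by rewrite deriveB//; apply: diff_derivable; [exact: df|exact: dg].
have dDf v : derivable ('D_v f) z v.
  by apply: diff_derivable; have [+ _] := Df v; apply.
have dDg v : derivable ('D_v g) z v.
  by apply: diff_derivable; have [+ _] := Dg v; apply.
have DD v : 'D_v f z = 'D_v g z /\ 'D_v ('D_v f) z <= 'D_v ('D_v g) z.
  have [|||D0 D2] := @local_max_derive2 _ _ (f - g) z v.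
  - near=> y; have Dy : D y by near: y.
    by apply: derivableB; apply: diff_derivable; [exact: df|exact: dg].
  - apply: near_eq_derivable (derivableB (dDf v) (dDg v)).
    by near=> y; apply/esym; near: y; exact: nDfg.
  - near=> y; have Dy : D y by near: y.
    by move: Dy; near: y.
  split.
    apply/eqP; rewrite -subr_eq0 -D0 deriveB//; apply: diff_derivable.
      exact: df.
    exact: dg.
  by rewrite -subr_le0 -deriveB// -(near_eq_derive _ (nDfg v)).
split=> [||y].
- by apply/rowP => i; rewrite !mxE; exact: (DD _).1.
- exact: (DD _).1.
- have := (DD (y, 0)).2.
  by move: (derive2_space _ _ _ y oD Cf Dz) (derive2_space _ _ _ y oD Cg Dz) => -> ->.
Unshelve. all: by end_near. Qed.

Lemma local_min_max_sub {R : realType} {n : nat} (D : set ('rV[R]_n * R))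
    (f g : 'rV[R]_n * R -> R) (z : 'rV[R]_n * R) :
  local_min_in D (fun z => f z - g z) z ->
  local_max_in D (fun z => g z - f z) z.
Proof. by apply: filterS => y fg /fg; rewrite -lerN2 !opprB. Qed.

(* At a critical point of u (a = 0) this leaves the direction e free, as in the
   definition of viscosity solutions; otherwise e = +- Du / |Du|. *)
Definition solves_at {R : realType} {n : nat} (p : R)
    (u : 'rV[R]_n * R -> R) (z : 'rV[R]_n * R) : Prop :=
  exists (e : 'rV[R]_n) (a : R), [/\ enorm e = 1, grad u z = a *: e &
    Dt u z = op_singular p e (hess u z)].

Lemma solves_touching_above {R : realType} {n : nat} (p : R)
    (D : set ('rV[R]_n * R)) (u phi : 'rV[R]_n * R -> R) (z : 'rV[R]_n * R) :
  1 < p -> open D -> Ck_on 2 D u -> solves_at p u z ->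
  Ck_on 2 D phi -> D z -> local_max_in D (fun z => u z - phi z) z ->
  (grad phi z <> 0 -> Dt phi z <= op_regular p (grad phi z) (hess phi z)) /\
  (grad phi z = 0 ->
     exists a, enorm a <= 1 /\ Dt phi z <= op_singular p a (hess phi z)).
Proof.
move=> p1 oD Cu [e [a [e1 guE utE]]] Cphi Dz umax.
have [<- <- qle] := local_max_sub_Ck2 _ _ _ _ oD Cu Cphi Dz umax.
rewrite utE guE; move: (hess u z) (hess phi z) qle => H H' qle.
have HH' := op_singular_le _ _ _ _ p1 e1 qle.
(* If the common gradient vanishes, [e] is the witness; otherwise [a] is nonzero and the regular
   operator at [a *: e] is the singular one at [e]. *)
split=> [/eqP|_]; last by exists e; rewrite e1.
by rewrite scaler_eq0 negb_or => /andP[a0 _]; rewrite op_regularZ.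
Qed.

(** Here it is [phi - u] that has the local maximum, so the Hessian inequality is reversed. *)
Lemma solves_touching_below {R : realType} {n : nat} (p : R)
    (D : set ('rV[R]_n * R)) (u phi : 'rV[R]_n * R -> R) (z : 'rV[R]_n * R) :
  1 < p -> open D -> Ck_on 2 D u -> solves_at p u z ->
  Ck_on 2 D phi -> D z -> local_min_in D (fun z => u z - phi z) z ->
  (grad phi z <> 0 -> Dt phi z >= op_regular p (grad phi z) (hess phi z)) /\
  (grad phi z = 0 ->
     exists a, enorm a <= 1 /\ Dt phi z >= op_singular p a (hess phi z)).
Proof.
move=> p1 oD Cu [e [a [e1 guE utE]]] Cphi Dz umin.
have [-> -> qle] := local_max_sub_Ck2 _ _ _ _ oD Cphi Cu Dz
  (local_min_max_sub _ _ _ _ umin).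
rewrite utE guE; move: (hess u z) (hess phi z) qle => H H' qle.
have HH' := op_singular_le _ _ _ _ p1 e1 qle.
split=> [/eqP|_]; last by exists e; rewrite e1.
by rewrite scaler_eq0 negb_or => /andP[a0 _]; rewrite op_regularZ.
Qed.

(** * Expansion of the divergence *)

Lemma sumr_delta {R : realType} {n : nat} (i : 'I_n) (F : 'I_n -> R) :
  \sum_(j < n) (i == j)%:R * F j = F i.
Proof.
rewrite (bigD1 i)//= eqxx mul1r big1 ?addr0// => j ji.
by rewrite eq_sym (negbTE ji) mul0r.
Qed.

(** The square N of |Du| is a sum of products of differentiable functions and is positive at [z], so
    the chain rule applies to its power with exponent (p - 2) / 2. *)
Lemma div_flux {R : realType} {n : nat} (p : R) (U : set ('rV[R]_n * R))
    (u : 'rV[R]_n * R -> R) (z : 'rV[R]_n * R) :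
  Ck_on 2 U u -> U z -> grad u z <> 0 ->
  (forall i, derivable (flux p u i) z (delta_mx ord0 i, 0)) /\
  \sum_(i < n) Dx i (flux p u i) z =
    enorm (grad u z) `^ (p - 2) * op_regular p (grad u z) (hess u z).
Proof.
move=> [_ Du] Uz /eqP; rewrite -enorm_eq0 => q0.
pose N := \sum_(i < n) Dx i u * Dx i u; pose s := 2^-1 * (p - 2).
have NE y : N y = enorm (grad u y) ^+ 2.
  rewrite sqr_enorm /N fct_sumE; apply: eq_bigr => i _.
  by rewrite !mxE expr2.
have N0 : 0 < N z by rewrite NE exprn_gt0// lt_neqAle eq_sym q0 enorm_ge0.
have dq i : differentiable (Dx i u) z by have [+ _] := Du (delta_mx ord0 i, 0); apply.
have dN : differentiable N z by apply: differentiable_sum => i; exact: differentiableM.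
have DN v : 'D_v N z = \sum_(j < n) 2 * (Dx j u z * 'D_v (Dx j u) z).
  rewrite derive_sum => [|j]; last exact/diff_derivable/differentiableM.
  apply: eq_bigr => j _; rewrite deriveM; try exact: diff_derivable.
  by rewrite -[_ *: _]/(_ * _); ring.
(* Valid at every [y], critical points included, so that [fluxE] is an equality of functions and can
   be differentiated. *)
have normE y : enorm (grad u y) `^ (p - 2) = N y `^ s.
  by rewrite powRrM powR12_sqrt NE ?sqr_ge0// sqrtr_sqr ger0_norm ?enorm_ge0.
have fluxE i : flux p u i = (((@powR R)^~ s) \o N) * Dx i u.
  by apply/funext => y; rewrite /flux normE.
have [dP DP] : differentiable (((@powR R)^~ s) \o N) z /\
    forall v, 'D_v (((@powR R)^~ s) \o N) z = s * N z `^ (s - 1) * 'D_v N z.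
  have H v := derive_comp_real N ((@powR R)^~ s) z v _ dN (is_derive1_powR s N0).
  by split=> [|v]; [exact: (H 0).1|exact: (H v).2].
split=> [i|].
  by rewrite fluxE; apply: diff_derivable; exact: differentiableM.
have Nr1 : N z `^ (s - 1) = N z `^ s / N z.
  by rewrite powRB ?powRr1 ?(ltW N0)// (gt_eqF N0) implybT.
transitivity (\sum_(i < n) (N z `^ s * hess u z i i) +
    \sum_(i < n) \sum_(j < n) N z `^ s *
      ((p - 2) * (Dx i u z * Dx j u z / N z) * Dx i (Dx j u) z)).
  rewrite -big_split/=; apply: eq_bigr => i _.
  rewrite [LHS]/Dx fluxE deriveM; [|exact: diff_derivable|exact: diff_derivable].
  rewrite DP DN Nr1 mxE; congr (_ + _).
  rewrite !mulr_sumr -[_ *: _]/(_ * _) mulr_sumr; apply: eq_bigr => j _.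
  rewrite -/(Dx i (Dx j u) z).
  move: (Dx i u z) (Dx j u z) (Dx i (Dx j u) z) (N z `^ s) (N z) N0 => a b c d m m0.
  by rewrite /s; field; rewrite gt_eqF.
(* The chain rule produces [Dx i (Dx j u)], while [hess] has [Dx j (Dx i u)] at entry (i, j). The
   coefficient is symmetric in i and j, so exchanging the sums matches the two. *)
rewrite exchange_big -big_split normE /op_regular -NE mulr_sumr; apply: eq_bigr => i _ /=.
under [in RHS]eq_bigr do rewrite mulrDl.
rewrite big_split/= sumr_delta mulrDr; congr (_ + _).
rewrite mulr_sumr; apply: eq_bigr => j _; rewrite !mxE.
by move: (Dx i u z) (Dx j u z) (Dx j (Dx i u) z) (N z) (_ `^ s) => *; ring.
Qed.

(** * Coordinate functions and their derivatives *)

Section coordinates.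
Context {R : realType} {n : nat}.
Local Notation V := ('rV[R]_n * R)%type.

Definition positive_times : set V := [set z | 0 < z.2].

Lemma open_positive_times : open positive_times.
Proof.
apply: (@open_comp _ _ (@snd 'rV[R]_n R) [set x | 0 < x]); last exact: open_gt.
by move=> z _; exact: cvg_snd.
Qed.

Definition coordx (i : 'I_n) (z : V) : R := z.1 ord0 i.
Definition coordt (z : V) : R := z.2.

Lemma linear_coordx i : linear (coordx i).
Proof. by move=> a x y; rewrite /coordx !mxE. Qed.

Lemma continuous_coordx i : continuous (coordx i).
Proof.
move=> z; apply: (@continuous_comp _ _ _ (fst : V -> _) (fun x => x ord0 i : R)).
  exact: cvg_fst.
exact: coord_continuous.
Qed.

Lemma linear_coordt : linear coordt. Proof. by []. Qed.

Lemma continuous_coordt : continuous coordt.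
Proof. by move=> z; exact: cvg_snd. Qed.

Lemma derive_coordx i (z v : V) :
  differentiable (coordx i) z /\ 'D_v (coordx i) z = v.1 ord0 i.
Proof. exact: (linear_derive _ _ _ (linear_coordx i) (@continuous_coordx i)). Qed.

Lemma derive_coordt (z v : V) :
  differentiable coordt z /\ 'D_v coordt z = v.2.
Proof. exact: (linear_derive _ _ _ linear_coordt continuous_coordt). Qed.

Definition invt (z : V) : R := (coordt z)^-1.

Lemma derive_invt (z v : V) : positive_times z ->
  differentiable invt z /\ 'D_v invt z = - (v.2 / z.2 ^+ 2).
Proof.
move=> t0; have [dt Dt] := derive_coordt z v.
have t0' : coordt z != 0 by rewrite gt_eqF.
split; first exact: differentiableV.
by rewrite deriveV ?Dt//; [rewrite -[_ *: _]/(_ * _) mulNr mulrC|exact: diff_derivable].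
Qed.

Definition sqx : V -> R := \sum_(i < n) coordx i * coordx i.

Lemma sqxE z : sqx z = enorm z.1 ^+ 2.
Proof.
rewrite sqr_enorm /sqx fct_sumE; apply: eq_bigr => i _.
by rewrite expr2.
Qed.

Lemma derive_sqx (z v : V) : differentiable sqx z /\
  'D_v sqx z = \sum_(i < n) 2 * (z.1 ord0 i * v.1 ord0 i).
Proof.
have dc i : differentiable (coordx i) z := (derive_coordx i z 0).1.
split; first by apply: differentiable_sum => i; exact: differentiableM.
rewrite derive_sum => [|i]; last exact/diff_derivable/differentiableM.
apply: eq_bigr => i _; rewrite deriveM; [|exact: diff_derivable..].
by rewrite (derive_coordx i z v).2 -[_ *: _]/(_ * _) /coordx; ring.
Qed.

End coordinates.

(** * The derivatives of G and the equation it satisfies *)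

(** For a unit vector e, the matrix I + (p - 2) e e^T has trace n + p - 2 and its product with e e^T
    has trace p - 1. These traces are the constants in the exponents of G. *)
Lemma op_singular_rank1 {R : realType} {n : nat} (p A B : R) (e : 'rV[R]_n) :
  enorm e = 1 ->
  op_singular p e
    (\matrix_(i, j) (A * (e ord0 i * e ord0 j) + B * (i == j)%:R)) =
  (p - 1) * A + (n%:R + p - 2) * B.
Proof.
move=> e1; have e2 : \sum_(i < n) e ord0 i ^+ 2 = 1.
  by rewrite -sqr_enorm e1 expr1n.
transitivity (\sum_(i < n) (e ord0 i ^+ 2 * ((p - 1) * A + (p - 2) * B) + B)).
  apply: eq_bigr => i _.
  transitivity (\sum_(j < n) ((i == j)%:R * (A * (e ord0 i * e ord0 j) + B
      * (i == j)%:R + (p - 2) * B * (e ord0 i * e ord0 j))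
      + (p - 2) * A * e ord0 i ^+ 2 * e ord0 j ^+ 2)).
    by apply: eq_bigr => j _; rewrite mxE; ring.
  by rewrite big_split/= sumr_delta -mulr_sumr e2 eqxx/=; ring.
by rewrite big_split/= -mulr_suml e2 sumr_const card_ord -mulr_natl; ring.
Qed.

Section Gp.
Context {R : realType} {n : nat} (p : R) (p1 : 1 < p).
Local Notation V := ('rV[R]_n * R)%type.
Local Notation G := (@Gp R n p).
Local Notation positive_times := (@positive_times R n).

Let alpha := (n%:R + p - 2) / (2 * (p - 1)).

(** For t > 0 [powR] is an exponential of a multiple of [ln], which makes G a single exponential.
    Sums and products are taken between functions to suit the closure rules of [Ck_on]. *)
Definition logGp : V -> R :=
  cst (- alpha) * (@ln R \o coordt) + cst (- (4 * (p - 1))^-1) * (sqx * invt).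

Lemma GpE : {in positive_times, expR \o logGp =1 G}.
Proof.
move=> z /[!inE] t0; rewrite /Gp /powR gt_eqF// -expRD/= /logGp !fctE sqxE /invt.
congr expR; rewrite /coordt -/alpha [in RHS]invfM; ring.
Qed.

Lemma Ck_on_Gp k : Ck_on k positive_times G.
Proof.
have oP := @open_positive_times R n.
have Ct : Ck_on k positive_times (@coordt R n).
  by apply: Ck_on_linear; [exact: linear_coordt|exact: continuous_coordt].
apply: (Ck_on_eq _ _ _ _ oP GpE); apply: Ck_on_expR => //.
rewrite /logGp; apply: Ck_onD => //; apply: Ck_onM => //; try exact: Ck_on_cst.
  exact: Ck_on_ln.
apply: Ck_onM => //; last by apply: Ck_onV => // z t0; rewrite gt_eqF.
apply: Ck_on_sum => // i; apply: Ck_onM => //; apply: Ck_on_linear.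
- exact: linear_coordx.
- exact: continuous_coordx.
- exact: linear_coordx.
- exact: continuous_coordx.
Qed.

(** One computation for all directions, specialised below to the coordinate and time directions. *)
Lemma derive_Gp (z v : V) : positive_times z -> 'D_v G z = G z *
  (- alpha * (v.2 / z.2) + (4 * (p - 1))^-1 * (enorm z.1 ^+ 2 * v.2 / z.2 ^+ 2)
   - (2 * (p - 1))^-1 * (\sum_(i < n) z.1 ord0 i * v.1 ord0 i) / z.2).
Proof.
move=> t0; have nP := open_nbhs_nbhs (conj (@open_positive_times R n) t0).
rewrite -(@near_eq_derive _ _ _ (expR \o logGp)); last first.
  by apply: filterS nP => y Py; apply: GpE; rewrite inE.
have [dt Dt] := derive_coordt z v.
have [ds Ds] := derive_sqx z v.
have [di Di] := derive_invt z v t0.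
have [dl Dl] := derive_comp_real _ _ z v _ dt (is_derive1_ln t0).
have dsi := differentiableM ds di.
have dA : differentiable (cst (- alpha) * (@ln R \o @coordt R n)) z.
  exact: differentiableM.
have dB : differentiable (cst (- (4 * (p - 1))^-1) * (sqx * @invt R n)) z.
  exact: differentiableM.
have [_ ->] := derive_comp_real _ _ z v _ (differentiableD dA dB)
  (is_derive_expR _).
(* With the exponential folded back into [G z] as a common factor, a rational identity for the
   derivative of the logarithm remains. *)
rewrite -[expR _]/((expR \o logGp) z) GpE ?inE//; congr (_ * _).
rewrite deriveD; [|exact: diff_derivable..].
rewrite deriveM; [|exact: diff_derivable..].
rewrite deriveM; [|exact: diff_derivable..].
rewrite deriveM; [|exact: diff_derivable..].
rewrite !derive_cst !scaler0 !addr0 Dl Dt Ds Di -mulr_sumr sqxE.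
rewrite /invt /coordt /cst -![_ *: _]/(_ * _).
move: (\sum_i _) (- alpha) (enorm _) => S a m.
by field; rewrite gt_eqF//= subr_eq0 gt_eqF.
Qed.

(** The spatial gradient of log G is minus [b z] times x. *)
Let b (z : V) := (2 * (p - 1))^-1 / z.2.

Lemma Dx_Gp (z : V) (i : 'I_n) : positive_times z ->
  Dx i G z = - b z * z.1 ord0 i * G z.
Proof.
move=> t0; rewrite /Dx derive_Gp//= !(mul0r, mulr0, add0r).
under eq_bigr do rewrite mxE eqxx/= mulrC eq_sym.
by rewrite sumr_delta /b; ring.
Qed.

(** In terms of b, alpha / t is (n + p - 2) b and |x|^2 / (4 (p - 1) t^2) is (p - 1) b^2 |x|^2; this
    is the shape that [op_singular_rank1] produces. *)
Lemma Dt_Gp (z : V) : positive_times z -> Dt G z = G z *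
  ((p - 1) * b z ^+ 2 * enorm z.1 ^+ 2 - (n%:R + p - 2) * b z).
Proof.
move=> t0; rewrite /Dt derive_Gp//= big1 => [|i _]; last by rewrite mxE mulr0.
rewrite /b /alpha; congr (_ * _); move: (enorm _) => m.
by field; rewrite gt_eqF//= subr_eq0 gt_eqF.
Qed.

Lemma hess_Gp (z : V) (i j : 'I_n) : positive_times z ->
  hess G z i j = G z *
    (b z ^+ 2 * (z.1 ord0 i * z.1 ord0 j) - b z * (i == j)%:R).
Proof.
move=> t0; have nP := open_nbhs_nbhs (conj (@open_positive_times R n) t0).
(* [Dx_Gp] is available for t > 0, so near [z] the first derivative is replaced by an explicit
   product; differentiating its factor G calls on [Dx_Gp] again. *)
rewrite mxE /Dx -(@near_eq_derive _ _ _
    (cst (- (2 * (p - 1))^-1) * (coordx i * invt) * G)); last first.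
  apply: filterS nP => y Py; rewrite [RHS]Dx_Gp// !fctE /b.
  by rewrite /coordx /invt /coordt; ring.
set v := (delta_mx ord0 j, 0).
have [dc Dc] := derive_coordx i z v.
have [di Di] := derive_invt z v t0.
have dG : differentiable G z by have [+ _] := Ck_on_Gp 1; exact.
have dci := differentiableM dc di.
have dA : differentiable (cst (- (2 * (p - 1))^-1) * (coordx i * invt)) z.
  exact: differentiableM.
rewrite (deriveM (diff_derivable dA) (diff_derivable dG)).
rewrite (deriveM (derivable_cst _ _ _) (diff_derivable dci)).
rewrite (deriveM (diff_derivable dc) (diff_derivable di)).
rewrite derive_cst Dc Di -/(Dx j G z) Dx_Gp// mxE eqxx/= !fctE /b.
rewrite /coordx /invt /coordt -![_ *: _]/(_ * _).
by move: (G z) ((2 * (p - 1))^-1) z.2^-1 (z.1 _ _) (z.1 _ _) => *; ring.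
Qed.

Lemma Gp_solves_at (z : V) : (1 <= n)%N -> positive_times z -> solves_at p G z.
Proof.
move=> n1 t0; have [e [c [e1 zE]]] : exists (e : 'rV[R]_n) (c : R),
    enorm e = 1 /\ z.1 = c *: e.
  have [z0|/eqP z0] := eqVneq z.1 0.
    (* At x = 0 the factor is 0 and any unit vector serves; [n1] provides a coordinate vector. *)
    by exists (delta_mx ord0 (Ordinal n1)), 0; rewrite enorm_delta z0 scale0r.
  exists ((enorm z.1)^-1 *: z.1), (enorm z.1).
  by rewrite enorm_normalize// scalerA mulfV ?scale1r// enorm_eq0; apply/eqP.
exists e, (- b z * c * G z); split=> //.
  by apply/rowP => i; rewrite !mxE Dx_Gp// zE mxE; ring.
have -> : hess G z = \matrix_(i, j)
    (G z * b z ^+ 2 * c ^+ 2 * (e ord0 i * e ord0 j) + - G z * b z * (i == j)%:R).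
  by apply/matrixP => i j; rewrite hess_Gp// zE !mxE; ring.
rewrite op_singular_rank1// Dt_Gp// zE enormZ e1 mulr1 real_normK ?num_real//.
ring.
Qed.

End Gp.

(** * The classical and the viscosity statement *)

(** The gradient is x times the nonzero scalar - b G. *)
Lemma grad_Gp_neq0 {R : realType} {n : nat} (p : R) (z : 'rV[R]_n * R) :
  1 < p -> 0 < z.2 -> z.1 <> 0 -> grad (Gp p) z <> 0.
Proof.
move=> p1 t0 x0 g0; apply: x0; apply/rowP => i; apply/eqP.
have G0 : 0 < Gp p z by rewrite mulr_gt0 ?powR_gt0 ?expR_gt0.
move/rowP/(_ i)/eqP: g0; rewrite !mxE Dx_Gp//; move: (Gp p z) G0 => G G0.
rewrite !mulf_eq0 oppr_eq0 mulf_eq0 !invr_eq0 mulf_eq0 pnatr_eq0 subr_eq0.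
by rewrite (gt_eqF t0) (gt_eqF p1) (gt_eqF G0) orbF.
Qed.

Lemma classical_solution_Gp {R : realType} {n : nat} (p : R) :
  (1 <= n)%N -> 1 < p ->
  classical_solution p ([set~ (0 : 'rV[R]_n)] `*` `]0, +oo[) (Gp p).
Proof.
move=> n1 p1; have Ut (z : 'rV[R]_n * R) :
    ([set~ (0 : 'rV[R]_n)] `*` [set` `]0, +oo[]) z -> 0 < z.2.
  by case=> _; rewrite /= in_itv/= andbT.
split=> [|z Uz]; first by apply: Ck_on_sub (Ck_on_Gp p 2) => z /Ut.
have t0 := Ut z Uz; have g0 := grad_Gp_neq0 p z p1 t0 Uz.1.
have [dflux ->] := div_flux p _ _ _ (Ck_on_Gp p 2) t0 g0.
split=> //; have [e [a [e1 gE ->]]] := Gp_solves_at p p1 z n1 t0.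
(* A nonzero gradient makes [a] nonzero, so the trace identity for [e] is the one for the regular
   operator. *)
move/eqP: g0; rewrite gE scaler_eq0 negb_or => /andP[a0 _].
by rewrite op_regularZ.
Qed.

(** As n >= 1 and p > 1, the exponent [a] is nonnegative, so t^(-a) is at most eps^(-a), and the
    exponential factor is at most 1. *)
Lemma bounded_Gp {R : realType} {n : nat} (p eps : R) :
  (1 <= n)%N -> 1 < p -> 0 < eps ->
  [bounded Gp p z | z in [set: 'rV[R]_n] `*` [set` `]eps, +oo[]].
Proof.
move=> n1 p1 eps0; pose a := (n%:R + p - 2) / (2 * (p - 1)).
have a0 : 0 <= a.
  have : 1 <= n%:R :> R by rewrite ler1n.
  by move=> n1'; rewrite divr_ge0//; lra.
exists ((eps `^ a)^-1); split; first exact: num_real.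
move=> M ltM z [_]; rewrite /= in_itv/= andbT => epst.
apply: le_trans (ltW ltM); have t0 := lt_trans eps0 epst.
rewrite /Gp -/a ger0_norm ?mulr_ge0 ?powR_ge0 ?expR_ge0// powRN.
rewrite -[leRHS]mulr1 ler_pM ?invr_ge0 ?powR_ge0 ?expR_ge0//.
  rewrite lef_pV2 ?posrE ?powR_gt0//.
  by apply: (ge0_ler_powR a0); rewrite ?nnegrE ltW.
by rewrite expR_le1 oppr_le0 divr_ge0 ?sqr_ge0// !mulr_ge0 ?(ltW t0)//; lra.
Qed.

Lemma viscosity_solution_Gp {R : realType} {n : nat} (p eps : R) :
  (1 <= n)%N -> 1 < p -> 0 < eps ->
  viscosity_solution p [set: 'rV[R]_n] `]eps, +oo[ (Gp p).
Proof.
move=> n1 p1 eps0.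
have Ipos (z : 'rV[R]_n * R) : [set` `]eps, +oo[] z.2 -> 0 < z.2.
  by rewrite /= in_itv/= andbT; exact: lt_trans.
pose D := [set: 'rV[R]_n] `*` [set` `]eps, +oo[]°.
have Dpos z : D z -> 0 < z.2 by move=> [_ /interior_subset /Ipos].
have oD : open D.
  rewrite (_ : D = snd @^-1` [set` `]eps, +oo[]°); last first.
    by apply/seteqP; split=> [z []//|z]; split.
  apply: open_comp; last exact: open_interior.
  by move=> z _; exact: cvg_snd.
have CD : Ck_on 2 D (Gp p) by apply: Ck_on_sub (Ck_on_Gp p 2).
have Gc : {within [set: 'rV[R]_n] `*` [set` `]eps, +oo[], continuous (Gp p)}.
  apply: continuous_in_subspaceT => z /[!inE] -[_ /Ipos].
  exact: (Ck_on_Gp p 0).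
have Gb := bounded_Gp p eps n1 p1 eps0.
split; split=> // phi z Cphi Dz touch.
- exact: (solves_touching_above _ _ _ _ _ p1 oD CD
    (Gp_solves_at p p1 z n1 (Dpos z Dz)) Cphi Dz touch).
- exact: (solves_touching_below _ _ _ _ _ p1 oD CD
    (Gp_solves_at p p1 z n1 (Dpos z Dz)) Cphi Dz touch).
Qed.

Theorem proposition4p1 (R : realType) (n : nat) (hn : (1 <= n)%N)
    (p : R) (hp : 1 < p) :
  classical_solution p ([set~ (0 : 'rV[R]_n)] `*` `]0, +oo[) (Gp p) /\
  (forall eps : R, 0 < eps ->
     viscosity_solution p [set: 'rV[R]_n] `]eps, +oo[ (Gp p)).
Proof.
split; first exact: classical_solution_Gp.
by move=> eps eps0; exact: viscosity_solution_Gp.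
Qed.
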